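(* Let $(\mathcal{K},c,\gamma)$ be a simplicial flow network and let $y=[y_{d-1},y_d]$ be an optimal solution to (LP2). Then $\mathsf{supp}(y_d)$ is a directed combinatorial $\gamma$-cut and $y_d=\delta(y_{d-1})^-$. Moreover, $\sum_{\sigma\in\mathcal{K}^d}c(\sigma)y_d(\sigma)=\min_p \sum_{\sigma\in\mathcal{K}^d}c(\sigma)\,\delta(p)^-(\sigma)$, where $p$ ranges over all $\gamma$-cuts.
   Context: A simplicial flow network is a triple $(\mathcal{K},c,\gamma)$ where $\mathcal{K}$ is a finite oriented $d$-dimensional simplicial complex (simplices oriented by a fixed linear order on vertices, $\mathcal{K}^k$ the set of $k$-simplices, real chains, boundary $\partial$, coboundary $\delta p=p\circ\partial$), $c\colon\mathcal{K}^d\to\mathbb{R}_{\ge0}$, and $\gamma$ is a null-homologous $(d-1)$-cycle. A $\gamma$-cut is a $(d-1)$-cochain $p$ with $p(\gamma)=-1$. For a $(d-1)$-cochain $p$ with $\delta(p)=\sum_i\alpha_i\sigma_i$, define its negative part as the non-negative chain $\delta(p)^-=\sum_{\alpha_i<0}(-\alpha_i)\sigma_i$. Adjoin to $C_d(\mathcal{K})$ an extra formal basis element $\Sigma$ with $\partial\Sigma=-\gamma$ and $c(\Sigma)=+\infty$. (LP2) has variables $y_{d-1}\colon\mathcal{K}^{d-1}\to\mathbb{R}$ and $y_d\colon\mathcal{K}^d\cup\{\Sigma\}\to\mathbb{R}$; it minimizes $\sum_{\sigma\in\mathcal{K}^d\cup\{\Sigma\}} y_d(\sigma)c(\sigma)$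 (with $0\cdot\infty=0$) subject to $y_{d-1}\cdot\partial\sigma+y_d(\sigma)\ge0$ for each $\sigma\in\mathcal{K}^d$, $y_{d-1}\cdot\partial\Sigma+y_d(\Sigma)=1$, and $y_d\ge0$, where $y_{d-1}\cdot\partial\sigma$ is $y_{d-1}$ evaluated on $\partial\sigma$. A directed combinatorial $\gamma$-cut is a set $C\subseteq\mathcal{K}^d$ such that no $d$-chain with non-negative coefficients supported on $\mathcal{K}^d\setminus C$ has boundary $\gamma$.
   Formalization: The equality y_d = δ(y_{d-1})^- is stated only on simplices with nonzero capacity, since y_d can be raised freely where c = 0; an optimal solution is required to have finite objective value, which excludes only γ = 0, where no γ-cut exists. *)

(* Defs.v *)
From HB Require Import structures.
From mathcomp Require Import all_boot all_order all_algebra.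
From mathcomp Require Import reals constructive_ereal.
Set Implicit Arguments.
Unset Strict Implicit.
Unset Printing Implicit Defensive.
Import Order.TTheory GRing.Theory Num.Theory.
Local Open Scope ring_scope.

Section Complexes.
Variables (disp : Order.disp_t) (T : finOrderType disp) (K : {set {set T}}).

Definition simplicial_complex : Prop :=
  set0 \notin K /\
  (forall s t : {set T}, s \in K -> t \subset s -> t != set0 -> t \in K).

Definition has_dimension (d : nat) : Prop :=
  (\max_(s in K) #|s|)%N = d.+1.

(* Indexed by the number of vertices: simplex n is the set of
   (n-1)-dimensional simplices, so the d-simplices form simplex d.+1 and the
   (d-1)-simplices form simplex d. *)
Definition simplex (n : nat) : finType := {s : {set T} | (s \in K) && (#|s| == n)}.

Variable R : realType.

(* Real chains, and also cochains, which are given by their values on the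
   basis of simplices. *)
Definition chain (n : nat) : Type := {ffun simplex n -> R}.

Definition position (s : {set T}) (v : T) : nat := #|[set u in s | (u < v)%O]|.

Definition boundary1 (n : nat) (s : simplex n.+1) : chain n :=
  [ffun t => \sum_(v in val s | val s :\ v == val t) (-1) ^+ position (val s) v].

Definition boundary (n : nat) (x : chain n.+1) : chain n :=
  [ffun t => \sum_s x s * boundary1 s t].

Definition cochain_eval (n : nat) (p x : chain n) : R := \sum_t p t * x t.

Definition coboundary (n : nat) (p : chain n) : chain n.+1 :=
  [ffun s => cochain_eval p (boundary1 s)].

Definition negative_part (n : nat) (a : chain n) : chain n :=
  [ffun s => if a s < 0 then - a s else 0].

End Complexes.

(* The (d-1)-chain gamma is only required to bound, since a boundary is a
   cycle. *)
Record flow_network (disp : Order.disp_t) (T : finOrderType disp) (R : realType)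
    (d : nat) (K : {set {set T}}) (c : simplex K d.+1 -> R) (gamma : chain K R d)
    : Prop := FlowNetwork {
  network_dim_gt0 : (0 < d)%N;
  network_complex : simplicial_complex K;
  network_dim : has_dimension K d;
  network_capacity_ge0 : forall s, 0 <= c s;
  network_null_homologous : exists x : chain K R d.+1, boundary x = gamma
}.

Section Cuts.
Variables (disp : Order.disp_t) (T : finOrderType disp) (R : realType).
Variables (d : nat) (K : {set {set T}}).
Variables (c : simplex K d.+1 -> R) (gamma : chain K R d).

Definition gamma_cut (p : chain K R d) : Prop := cochain_eval p gamma = -1.

Definition directed_combinatorial_cut (C : {set simplex K d.+1}) : Prop :=
  ~ exists x : chain K R d.+1,
      [/\ forall s, 0 <= x s, forall s, s \in C -> x s = 0 & boundary x = gamma].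

Definition cut_cost (p : chain K R d) : R :=
  \sum_s c s * negative_part (coboundary p) s.

(* option (simplex K d.+1) is the set of d-simplices with the extra basis
   element Sigma, encoded as None, adjoined. *)
Definition ext_boundary1 (s : option (simplex K d.+1)) : chain K R d :=
  if s is Some s' then boundary1 R s' else - gamma.

Definition ext_capacity (s : option (simplex K d.+1)) : \bar R :=
  if s is Some s' then (c s')%:E else +oo%E.

Definition lp2_objective (yd : {ffun option (simplex K d.+1) -> R}) : \bar R :=
  (\sum_s (yd s)%:E * ext_capacity s)%E.

Definition lp2_feasible (y1 : chain K R d)
    (yd : {ffun option (simplex K d.+1) -> R}) : Prop :=
  [/\ forall s, 0 <= cochain_eval y1 (ext_boundary1 (Some s)) + yd (Some s),
      cochain_eval y1 (ext_boundary1 None) + yd None = 1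
    & forall s, 0 <= yd s].

(* As usual for extended-real-valued objectives, a minimizer has finite value:
   if the objective is +oo on the whole feasible set (which happens exactly for
   gamma = 0, when there is no gamma-cut either) there is no optimal solution. *)
Definition lp2_optimal (y1 : chain K R d)
    (yd : {ffun option (simplex K d.+1) -> R}) : Prop :=
  [/\ lp2_feasible y1 yd, (lp2_objective yd < +oo)%E
    & forall z1 zd, lp2_feasible z1 zd -> (lp2_objective yd <= lp2_objective zd)%E].

End Cuts.

(* Main.v *)
Require Import Defs.
From HB Require Import structures.
From mathcomp Require Import all_boot all_order all_algebra.
From mathcomp Require Import reals constructive_ereal.
Set Implicit Arguments.
Unset Strict Implicit.
Unset Printing Implicit Defensive.
Import Order.TTheory GRing.Theory Num.Theory.
Local Open Scope ring_scope.

(** A finite objective forces [yd Sigma = 0], so [y1] is a gamma-cut, and the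
    remaining constraints say that [yd] dominates the negative part of its
    coboundary. Conversely every gamma-cut [p] yields the feasible point
    [(p, negative_part (coboundary p))], whose objective is the cost of [p];
    optimality thus squeezes the objective of [yd] between the cost of [y1] and
    the cost of every gamma-cut, and equality holds term by term because
    [c >= 0]. A nonnegative chain [x] bounding gamma off the support of [yd]
    would give [-1 = y1(gamma) = coboundary y1 (x) >= 0]. *)

Lemma big_option (A : Type) (idx : A) (op : Monoid.com_law idx) (I : finType)
    (F : option I -> A) :
  \big[op/idx]_i F i = op (F None) (\big[op/idx]_i F (Some i)).
Proof.
rewrite (bigD1 None) //=; congr (op _ _).
rewrite (reindex_omap Some id) /=; last by case.
by apply: eq_bigl => i; rewrite eqxx.
Qed.

Section Cochains.
Variables (disp : Order.disp_t) (T : finOrderType disp) (R : realType).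
Variable K : {set {set T}}.

(** Discrete Stokes formula: both sides are the same double sum, summed in the two orders. *)
Lemma cochain_eval_boundary n (p : chain K R n) (x : chain K R n.+1) :
  cochain_eval p (boundary x) = cochain_eval (coboundary p) x.
Proof.
rewrite /cochain_eval.
under eq_bigr do rewrite ffunE mulr_sumr.
rewrite exchange_big /=; apply: eq_bigr => s _.
by rewrite ffunE mulr_suml; apply: eq_bigr => t _; rewrite mulrCA mulrC.
Qed.

Lemma cochain_evalN n (p x : chain K R n) :
  cochain_eval p (- x) = - cochain_eval p x.
Proof. by rewrite -sumrN; apply: eq_bigr => t _; rewrite ffunE mulrN. Qed.

Lemma negative_part_ge0 n (a : chain K R n) s : 0 <= negative_part a s.
Proof. by rewrite ffunE; case: ifP => // /ltW; rewrite oppr_ge0. Qed.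

Lemma addr_negative_part_ge0 n (a : chain K R n) s :
  0 <= a s + negative_part a s.
Proof. by rewrite ffunE; case: ltP => [_|]; rewrite ?subrr ?addr0. Qed.

Lemma negative_part_le n (a : chain K R n) s (b : R) :
  0 <= b -> 0 <= a s + b -> negative_part a s <= b.
Proof. by rewrite ffunE; case: ifP => // _ _; rewrite -lerBlDl sub0r. Qed.

End Cochains.

Section LP2.
Variables (disp : Order.disp_t) (T : finOrderType disp) (R : realType).
Variables (d : nat) (K : {set {set T}}).
Variables (c : simplex K d.+1 -> R) (gamma : chain K R d).
Implicit Type yd : {ffun option (simplex K d.+1) -> R}.

Lemma lp2_objectiveE yd :
  lp2_objective c yd =
  ((yd None)%:E * +oo + (\sum_s c s * yd (Some s))%:E)%E.
Proof.
rewrite /lp2_objective big_option /=; congr (_ + _)%E.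
by rewrite -sumEFin; apply: eq_bigr => s _; rewrite -EFinM mulrC.
Qed.

Lemma lp2_objective_fin yd :
  yd None = 0 -> lp2_objective c yd = (\sum_s c s * yd (Some s))%:E.
Proof. by move=> y0; rewrite lp2_objectiveE y0 mul0e add0e. Qed.

(** The sum over the [d]-simplices is a real number, so it cannot offset an infinite term at
    [None]. *)
Lemma lp2_objective_lty yd :
  0 <= yd None -> (lp2_objective c yd < +oo)%E -> yd None = 0.
Proof.
rewrite le_eqVlt => /predU1P[<- //|y_gt0].
by rewrite lp2_objectiveE gt0_muley ?lte_fin // addye.
Qed.

Lemma lp2_feasible_cut (y1 : chain K R d) yd :
  lp2_feasible gamma y1 yd -> yd None = 0 -> gamma_cut gamma y1.
Proof.
case=> _ + _ y0; rewrite y0 addr0 /= cochain_evalN => y1g.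
by rewrite /gamma_cut -y1g opprK.
Qed.

Lemma lp2_feasible_ge (y1 : chain K R d) yd s :
  lp2_feasible gamma y1 yd -> negative_part (coboundary y1) s <= yd (Some s).
Proof.
by case=> y1_ge _ yd_ge0; apply: negative_part_le; rewrite // ffunE; apply: y1_ge.
Qed.

(** For a gamma-cut [p], this is the pointwise least [yd] that is feasible together with [p]. *)
Definition cut_solution (p : chain K R d) :
    {ffun option (simplex K d.+1) -> R} :=
  [ffun s => if s is Some s' then negative_part (coboundary p) s' else 0].

Lemma cut_solution_feasible (p : chain K R d) :
  gamma_cut gamma p -> lp2_feasible gamma p (cut_solution p).
Proof.
move=> pg; split=> [s||[s|]]; rewrite ffunE //.
- by have := addr_negative_part_ge0 (coboundary p) s; rewrite {1}ffunE.
- by rewrite addr0 /= cochain_evalN pg opprK.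
- exact: negative_part_ge0.
Qed.

Lemma cut_solution_objective (p : chain K R d) :
  lp2_objective c (cut_solution p) = (cut_cost c p)%:E.
Proof.
rewrite lp2_objective_fin; last by rewrite ffunE.
by congr EFin; apply: eq_bigr => s _; rewrite ffunE.
Qed.

Lemma lp2_feasible_directed_cut (y1 : chain K R d) yd :
  lp2_feasible gamma y1 yd -> yd None = 0 ->
  directed_combinatorial_cut gamma [set s | yd (Some s) != 0].
Proof.
move=> feas y0 [x [x_ge0 x_off xg]].
have := lp2_feasible_cut feas y0; rewrite /gamma_cut -xg cochain_eval_boundary.
move/eqP; apply/negP; rewrite gt_eqF // (lt_le_trans (ltrN10 _)) //.
(* Off the support of [yd], feasibility makes the coboundary nonnegative; on it, [x] vanishes. *)
apply: sumr_ge0 => s _; have [ys0|ys0] := eqVneq (yd (Some s)) 0.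
  apply: mulr_ge0 => //; case: feas => /(_ s) + _ _.
  by rewrite ys0 addr0 ffunE.
by rewrite (x_off s) ?mulr0 // inE.
Qed.

End LP2.

(** The formula for [yd] is claimed only where [c s != 0]: on a simplex of capacity zero, [yd] can
    be raised without changing feasibility or the objective. *)
Theorem theorem13 (R : realType) (disp : Order.disp_t) (T : finOrderType disp)
    (d : nat) (K : {set {set T}}) (c : simplex K d.+1 -> R) (gamma : chain K R d)
    (y1 : chain K R d) (yd : {ffun option (simplex K d.+1) -> R}) :
  flow_network c gamma ->
  lp2_optimal c gamma y1 yd ->
  [/\ yd None = 0
        /\ directed_combinatorial_cut gamma [set s | yd (Some s) != 0],
      forall s, c s != 0 -> yd (Some s) = negative_part (coboundary y1) s
    & let v := \sum_s c s * yd (Some s) in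
      (exists2 p, gamma_cut gamma p & cut_cost c p = v)
      /\ (forall p, gamma_cut gamma p -> v <= cut_cost c p)].
Proof.
case=> _ _ _ c_ge0 _ [feas fin_obj opt].
have y0 : yd None = 0 by case: feas => _ _ yd_ge0; apply: lp2_objective_lty fin_obj.
have y1_cut := lp2_feasible_cut feas y0.
have v_le p : gamma_cut gamma p -> \sum_s c s * yd (Some s) <= cut_cost c p.
  move=> /cut_solution_feasible/opt.
  by rewrite cut_solution_objective lp2_objective_fin.
have le_term s : c s * negative_part (coboundary y1) s <= c s * yd (Some s).
  by apply: ler_wpM2l => //; apply: lp2_feasible_ge feas.
have y1_cost : cut_cost c y1 = \sum_s c s * yd (Some s).
  (* One inequality is termwise; the other is optimality tested against the cut [y1] itself. *)
  by apply/eqP; rewrite eq_le v_le // ler_sum.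
split; [by split=> //; apply: lp2_feasible_directed_cut feas y0 | | ].
  move=> s cs0; apply: (mulfI cs0); apply/eqP; rewrite -subr_eq0.
  (* The termwise cost differences are nonnegative and sum to zero, so each one vanishes. *)
  have /psumr_eq0P : forall s, true ->
      0 <= c s * yd (Some s) - c s * negative_part (coboundary y1) s.
    by move=> t _; rewrite subr_ge0.
  by rewrite sumrB -y1_cost subrr => /(_ erefl s isT) ->.
by split=> //; exists y1.
Qed.
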